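(* Let $\mathbb{X}$ be a Cartesian difference category with infinitesimal extension $\varepsilon$ and difference combinator $\boldsymbol\partial$. For any map $f:A\to B$ and any object $C$ and maps $x,y,z:C\to A$: (i) $\boldsymbol\partial[f]\circ\langle x,\varepsilon(y)\rangle=\varepsilon(\boldsymbol\partial[f])\circ\langle x,y\rangle$; (ii) $\varepsilon(\boldsymbol\partial[f])\circ\langle x+\varepsilon(y),z\rangle=\varepsilon(\boldsymbol\partial[f])\circ\langle x+\varepsilon^2(y),z\rangle$; (iii) $\varepsilon^2(\boldsymbol\partial[\boldsymbol\partial[f]])\circ\langle\langle x,y\rangle,\langle z,0\rangle\rangle=\varepsilon^3(\boldsymbol\partial[\boldsymbol\partial[f]])\circ\langle\langle x,y\rangle,\langle z,0\rangle\rangle$.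
   Context: Composition is written $g\circ f$ (first $f$, then $g$); $\varepsilon^n$ denotes the $n$-fold iterate of the operator $\varepsilon$. A Cartesian category is a category with chosen finite products: binary products $A\times B$ with projections $\pi_0:A\times B\to A$, $\pi_1:A\times B\to B$, pairing $\langle -,-\rangle$, and terminal object $\top$. A left additive category is a category in which each hom-set is a commutative monoid $(+,0)$ with $(f+g)\circ h=f\circ h+g\circ h$ and $0\circ f=0$. A map $k$ is additive if $k\circ(f+g)=k\circ f+k\circ g$ and $k\circ 0=0$. A Cartesian left additive category is a Cartesian category that is also left additive and whose projections are all additive. An infinitesimal extension $\varepsilon$ on a Cartesian left additive category $\mathbb{X}$ consists of functions $\varepsilon:\mathbb{X}(A,B)\to\mathbb{X}(A,B)$ for all $A,B$ such that [E.1] $\varepsilon(f+g)=\varepsilon(f)+\varepsilon(g)$, $\varepsilon(0)=0$; [E.2] $\varepsilon(g\circ f)=\varepsilon(g)\circ f$; [E.3] $\varepsilon(\pi_i)=\pi_i\circ\varepsilon(1_{A\times B})$ for $i=0,1$. A Cartesian difference category is a Cartesian left additive category with an infinitesimal extension $\varepsilon$ and a difference combinator $\boldsymbol\partial$, assigning to each $f:A\to B$ a map $\boldsymbol\partial[f]:A\times A\to B$, such that (for all suitable maps): [C∂.0] $f\circ(x+\varepsilon(y))=f\circ x+\varepsilon(\boldsymbol\partial[f]\circ\langle x,y\rangle)$; [C∂.1] $\boldsymbol\partial[f+g]=\boldsymbol\partial[f]+\boldsymbol\partial[g]$, $\boldsymbol\partial[0]=0$, $\boldsymbol\partial[\varepsilon(f)]=\varepsilon(\boldsymbol\partial[f])$;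 [C∂.2] $\boldsymbol\partial[f]\circ\langle x,y+z\rangle=\boldsymbol\partial[f]\circ\langle x,y\rangle+\boldsymbol\partial[f]\circ\langle x+\varepsilon(y),z\rangle$, $\boldsymbol\partial[f]\circ\langle x,0\rangle=0$; [C∂.3] $\boldsymbol\partial[1_A]=\pi_1$, $\boldsymbol\partial[\pi_0]=\pi_0\circ\pi_1$, $\boldsymbol\partial[\pi_1]=\pi_1\circ\pi_1$; [C∂.4] $\boldsymbol\partial[\langle f,g\rangle]=\langle\boldsymbol\partial[f],\boldsymbol\partial[g]\rangle$; [C∂.5] $\boldsymbol\partial[g\circ f]=\boldsymbol\partial[g]\circ\langle f\circ\pi_0,\boldsymbol\partial[f]\rangle$; [C∂.6] $\boldsymbol\partial[\boldsymbol\partial[f]]\circ\langle\langle x,y\rangle,\langle 0,z\rangle\rangle=\boldsymbol\partial[f]\circ\langle x+\varepsilon(y),z\rangle$; [C∂.7] $\boldsymbol\partial[\boldsymbol\partial[f]]\circ\langle\langle x,y\rangle,\langle z,0\rangle\rangle=\boldsymbol\partial[\boldsymbol\partial[f]]\circ\langle\langle x,z\rangle,\langle y,0\rangle\rangle$. *)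

(* Defs.v *)
Set Implicit Arguments.
Unset Strict Implicit.
Unset Printing Implicit Defensive.

Declare Scope cat_scope.
Delimit Scope cat_scope with cat.
Open Scope cat_scope.

Reserved Notation "g ∘ f" (at level 40, left associativity).
Reserved Notation "A × B" (at level 40, left associativity).
Reserved Notation "⟨ f , g ⟩" (at level 0, f at level 99, g at level 99).
Reserved Notation "∂[ f ]" (at level 0, f at level 99).

Record Category := {
  obj :> Type;
  hom : obj -> obj -> Type;
  idm : forall A, hom A A;
  comp : forall A B C, hom B C -> hom A B -> hom A C;
  comp_assoc : forall A B C D (h : hom C D) (g : hom B C) (f : hom A B),
    comp h (comp g f) = comp (comp h g) f;
  comp_idl : forall A B (f : hom A B), comp (idm B) f = f;
  comp_idr : forall A B (f : hom A B), comp f (idm A) = f }.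

Arguments hom {_} A B.
Arguments idm {_} A.
Arguments comp {_ A B C} g f.
Notation "g ∘ f" := (comp g f) : cat_scope.

Record CartesianCategory := {
  cc_cat :> Category;
  prod_ob : cc_cat -> cc_cat -> cc_cat;
  pi0 : forall A B, hom (prod_ob A B) A;
  pi1 : forall A B, hom (prod_ob A B) B;
  pair : forall C A B, hom C A -> hom C B -> hom C (prod_ob A B);
  pi0_pair : forall C A B (f : hom C A) (g : hom C B), pi0 A B ∘ pair f g = f;
  pi1_pair : forall C A B (f : hom C A) (g : hom C B), pi1 A B ∘ pair f g = g;
  pair_unique : forall C A B (f : hom C A) (g : hom C B)
      (h : hom C (prod_ob A B)),
    pi0 A B ∘ h = f -> pi1 A B ∘ h = g -> h = pair f g;
  terminal : cc_cat;
  bang : forall A, hom A terminal;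
  bang_unique : forall A (f : hom A terminal), f = bang A }.

Arguments prod_ob {_} A B.
Arguments pi0 {_ A B}.
Arguments pi1 {_ A B}.
Arguments pair {_ C A B} f g.
Arguments terminal {_}.
Arguments bang {_} A.
Notation "A × B" := (prod_ob A B) : cat_scope.
Notation "⟨ f , g ⟩" := (pair f g) : cat_scope.

(* Only precomposition is required to preserve the monoid structure. *)
Record LeftAdditive (X : Category) := {
  la_add : forall A B : X, hom A B -> hom A B -> hom A B;
  la_zero : forall A B : X, hom A B;
  la_addA : forall A B (f g h : hom A B),
    la_add f (la_add g h) = la_add (la_add f g) h;
  la_addC : forall A B (f g : hom A B), la_add f g = la_add g f;
  la_add0 : forall A B (f : hom A B), la_add f (la_zero A B) = f;
  la_add_comp : forall A B C (f g : hom B C) (h : hom A B),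
    la_add f g ∘ h = la_add (f ∘ h) (g ∘ h);
  la_zero_comp : forall A B C (f : hom A B),
    la_zero B C ∘ f = la_zero A C }.

Definition additive (X : Category) (L : LeftAdditive X) (A B : X)
    (k : hom A B) : Prop :=
  (forall C (f g : hom C A),
     k ∘ la_add L f g = la_add L (k ∘ f) (k ∘ g)) /\
  (forall C, k ∘ la_zero L C A = la_zero L C B).

Record CartesianLeftAdditiveCategory := {
  clac_cc :> CartesianCategory;
  clac_la : LeftAdditive clac_cc;
  pi0_additive : forall A B : clac_cc, additive clac_la (@pi0 clac_cc A B);
  pi1_additive : forall A B : clac_cc, additive clac_la (@pi1 clac_cc A B) }.

Definition add (X : CartesianLeftAdditiveCategory) (A B : X)
  (f g : hom A B) : hom A B := la_add (clac_la X) f g.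
Definition zero (X : CartesianLeftAdditiveCategory) (A B : X) : hom A B :=
  la_zero (clac_la X) A B.
Arguments zero {_ A B}.
Notation "f + g" := (add f g) : cat_scope.
Notation "0" := (@zero _ _ _) : cat_scope.

Record InfinitesimalExtension (X : CartesianLeftAdditiveCategory) := {
  ext : forall A B : X, hom A B -> hom A B;
  ext_add : forall A B (f g : hom A B), ext (f + g) = ext f + ext g;
  ext_zero : forall A B, ext (0 : hom A B) = 0;
  ext_comp : forall A B C (g : hom B C) (f : hom A B),
    ext (g ∘ f) = ext g ∘ f;
  ext_pi0 : forall A B, ext (pi0 : hom (A × B) A) = pi0 ∘ ext (idm (A × B));
  ext_pi1 : forall A B, ext (pi1 : hom (A × B) B) = pi1 ∘ ext (idm (A × B)) }.

Record DifferenceCombinator (X : CartesianLeftAdditiveCategory)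
    (E : InfinitesimalExtension X) := {
  dc : forall A B : X, hom A B -> hom (A × A) B;
  Cd0 : forall A B C (f : hom A B) (x y : hom C A),
    f ∘ (x + ext E y) = f ∘ x + ext E (dc f ∘ ⟨x, y⟩);
  Cd1_add : forall A B (f g : hom A B), dc (f + g) = dc f + dc g;
  Cd1_zero : forall A B, dc (0 : hom A B) = 0;
  Cd1_ext : forall A B (f : hom A B), dc (ext E f) = ext E (dc f);
  Cd2_add : forall A B C (f : hom A B) (x y z : hom C A),
    dc f ∘ ⟨x, y + z⟩ = dc f ∘ ⟨x, y⟩ + dc f ∘ ⟨x + ext E y, z⟩;
  Cd2_zero : forall A B C (f : hom A B) (x : hom C A), dc f ∘ ⟨x, 0⟩ = 0;
  Cd3_id : forall A, dc (idm A) = pi1;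
  Cd3_pi0 : forall A B, dc (pi0 : hom (A × B) A) = pi0 ∘ pi1;
  Cd3_pi1 : forall A B, dc (pi1 : hom (A × B) B) = pi1 ∘ pi1;
  Cd4 : forall A B C (f : hom C A) (g : hom C B), dc ⟨f, g⟩ = ⟨dc f, dc g⟩;
  Cd5 : forall A B C (g : hom B C) (f : hom A B),
    dc (g ∘ f) = dc g ∘ ⟨f ∘ pi0, dc f⟩;
  Cd6 : forall A B C (f : hom A B) (x y z : hom C A),
    dc (dc f) ∘ ⟨⟨x, y⟩, ⟨0, z⟩⟩ = dc f ∘ ⟨x + ext E y, z⟩;
  Cd7 : forall A B C (f : hom A B) (x y z : hom C A),
    dc (dc f) ∘ ⟨⟨x, y⟩, ⟨z, 0⟩⟩ = dc (dc f) ∘ ⟨⟨x, z⟩, ⟨y, 0⟩⟩ }.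

Record CartesianDifferenceCategory := {
  cdc_clac :> CartesianLeftAdditiveCategory;
  cdc_ext : InfinitesimalExtension cdc_clac;
  cdc_dc : DifferenceCombinator cdc_ext }.

Definition eps (X : CartesianDifferenceCategory) (A B : X)
  (f : hom A B) : hom A B := ext (cdc_ext X) f.
Definition diff (X : CartesianDifferenceCategory) (A B : X)
  (f : hom A B) : hom (A × A) B := dc (cdc_dc X) f.
Notation ε := eps.
Notation "∂[ f ]" := (diff f) : cat_scope.

Definition eps_iter (X : CartesianDifferenceCategory) (n : nat) (A B : X)
  (f : hom A B) : hom A B := Nat.iter n (@eps X A B) f.
Notation "ε^ n" := (eps_iter n) (at level 1, n at level 0, format "ε^ n")
  : cat_scope.

(* Main.v *)
(** Each of the three identities follows by feeding a well-chosen pair to the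
    axioms. For (i), decompose [⟨x, ε y⟩ = ⟨x, 0⟩ + ε ⟨0, y⟩] and apply [C∂.0]
    and [C∂.6]. Read at the generic point, (i) says that [ε ∂[f]] is [∂[f]]
    precomposed with [⟨π0, ε π1⟩]; differentiating this by the chain rule gives
    [∂[∂[f]] ∘ ⟨⟨x, ε y⟩, ⟨u, ε v⟩⟩ = ε ∂[∂[f]] ∘ ⟨⟨x, y⟩, ⟨u, v⟩⟩]. For
    [u = 0] this is (ii), by [C∂.6]. For [v = 0] it says that
    [∂[∂[f]] ∘ ⟨⟨x, y⟩, ⟨z, 0⟩⟩] is ε-homogeneous in [y], so (iii) is (ii) for
    [∂[f]] at the point [⟨x, 0⟩] moved in the direction [⟨0, y⟩]. *)

Require Import Defs.

Lemma pair_comp (X : CartesianCategory) (A B C D : X)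
    (f : hom C A) (g : hom C B) (h : hom D C) :
  ⟨f, g⟩ ∘ h = ⟨f ∘ h, g ∘ h⟩.
Proof.
apply pair_unique; rewrite comp_assoc; [rewrite pi0_pair | rewrite pi1_pair];
  reflexivity.
Qed.

Lemma pair_eta (X : CartesianCategory) (A B : X) :
  ⟨pi0, pi1⟩ = idm (A × B).
Proof. symmetry; apply pair_unique; apply comp_idr. Qed.

Section LeftAdditive.
Set Implicit Arguments.
Unset Strict Implicit.
Variable X : CartesianLeftAdditiveCategory.

Lemma pair_add (A B C : X) (f f' : hom C A) (g g' : hom C B) :
  ⟨f, g⟩ + ⟨f', g'⟩ = ⟨f + f', g + g'⟩.
Proof.
apply pair_unique.
- unfold add; rewrite (proj1 (pi0_additive _ _)), !pi0_pair; reflexivity.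
- unfold add; rewrite (proj1 (pi1_additive _ _)), !pi1_pair; reflexivity.
Qed.

Lemma addr0 (A B : X) (f : hom A B) : f + 0 = f.
Proof. apply la_add0. Qed.

Lemma add0r (A B : X) (f : hom A B) : 0 + f = f.
Proof. unfold add; rewrite la_addC; apply la_add0. Qed.

Variable E : InfinitesimalExtension X.

(** [ext_pi0] concerns only the identity, but [ext E h] is [ext E (idm _) ∘ h] by [ext_comp], which
    carries it to every [h]. *)
Lemma pi0_ext (A B C : X) (h : hom C (A × B)) : pi0 ∘ ext E h = ext E (pi0 ∘ h).
Proof.
rewrite (ext_comp E pi0 h), ext_pi0, <- comp_assoc, <- ext_comp, comp_idl.
reflexivity.
Qed.

Lemma pi1_ext (A B C : X) (h : hom C (A × B)) : pi1 ∘ ext E h = ext E (pi1 ∘ h).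
Proof.
rewrite (ext_comp E pi1 h), ext_pi1, <- comp_assoc, <- ext_comp, comp_idl.
reflexivity.
Qed.

Lemma ext_pair (A B C : X) (f : hom C A) (g : hom C B) :
  ext E ⟨f, g⟩ = ⟨ext E f, ext E g⟩.
Proof.
apply pair_unique.
- rewrite pi0_ext, pi0_pair; reflexivity.
- rewrite pi1_ext, pi1_pair; reflexivity.
Qed.

Variable D : DifferenceCombinator E.

Lemma dc_homogeneous (A B C : X) (f : hom A B) (x y : hom C A) :
  dc D f ∘ ⟨x, ext E y⟩ = ext E (dc D f) ∘ ⟨x, y⟩.
Proof.
assert (H : ⟨x, ext E y⟩ = ⟨x, 0⟩ + ext E ⟨0, y⟩)
  by (rewrite ext_pair, ext_zero, pair_add, addr0, add0r; reflexivity).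
rewrite H, (Cd0 D), Cd2_zero, Cd6, ext_zero, addr0, add0r.
apply ext_comp.
Qed.

Lemma dc_dc_homogeneous (A B C : X) (f : hom A B) (x y u v : hom C A) :
  dc D (dc D f) ∘ ⟨⟨x, ext E y⟩, ⟨u, ext E v⟩⟩
  = ext E (dc D (dc D f)) ∘ ⟨⟨x, y⟩, ⟨u, v⟩⟩.
Proof.
assert (H : dc D f ∘ ⟨pi0, ext E pi1⟩ = ext E (dc D f))
  by (rewrite dc_homogeneous, pair_eta; apply comp_idr).
apply (f_equal (fun k => dc D k ∘ ⟨⟨x, y⟩, ⟨u, v⟩⟩)) in H.
(* The derivative of [⟨pi0, ext E pi1⟩] is the same map applied to the direction, so ε lands on both
   [y] and [v]. *)
rewrite Cd5, Cd4, !Cd1_ext, Cd3_pi0, Cd3_pi1 in H.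
rewrite <- H, <- comp_assoc, !pair_comp, <- !ext_comp, <- !comp_assoc.
rewrite !pi0_pair, !pi1_pair, pi0_pair; reflexivity.
Qed.

Lemma ext_dc_shift (A B C : X) (f : hom A B) (x y z : hom C A) :
  ext E (dc D f) ∘ ⟨x + ext E y, z⟩ = ext E (dc D f) ∘ ⟨x + ext E (ext E y), z⟩.
Proof.
(* Only the right side changes: its outer ε moves onto [z], and then one ε is pulled off
   [ext E (ext E y)] and [ext E z] together. *)
rewrite <- (dc_homogeneous f (x + ext E (ext E y))), <- Cd6, dc_dc_homogeneous.
rewrite <- !ext_comp, Cd6; reflexivity.
Qed.

Lemma dc_dc_homogeneous_base (A B C : X) (f : hom A B) (x y z : hom C A) :
  dc D (dc D f) ∘ ⟨⟨x, ext E y⟩, ⟨z, 0⟩⟩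
  = ext E (dc D (dc D f)) ∘ ⟨⟨x, y⟩, ⟨z, 0⟩⟩.
Proof.
rewrite <- (dc_dc_homogeneous f x y z 0), ext_zero; reflexivity.
Qed.

Lemma ext_dc_dc_idem (A B C : X) (f : hom A B) (x y z : hom C A) :
  ext E (ext E (dc D (dc D f))) ∘ ⟨⟨x, y⟩, ⟨z, 0⟩⟩
  = ext E (ext E (ext E (dc D (dc D f)))) ∘ ⟨⟨x, y⟩, ⟨z, 0⟩⟩.
Proof.
pose proof (ext_dc_shift (dc D f) ⟨x, 0⟩ ⟨0, y⟩ ⟨z, 0⟩) as H.
rewrite !ext_pair, !ext_zero, !pair_add, addr0, !add0r in H.
(* Now [y] carries one ε on the left and two on the right; pulled out and joined to the outer ε,
   they make two and three. *)
rewrite <- !ext_comp, !dc_dc_homogeneous_base in H.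
rewrite <- !ext_comp, dc_dc_homogeneous_base in H.
rewrite <- !ext_comp in *; exact H.
Qed.

End LeftAdditive.

Theorem lemma4p8 (X : CartesianDifferenceCategory) (A B : X) (f : hom A B)
    (C : X) (x y z : hom C A) :
  ∂[f] ∘ ⟨x, ε y⟩ = ε ∂[f] ∘ ⟨x, y⟩ /\
  ε ∂[f] ∘ ⟨x + ε y, z⟩ = ε ∂[f] ∘ ⟨x + ε^2 y, z⟩ /\
  ε^2 ∂[∂[f]] ∘ ⟨⟨x, y⟩, ⟨z, 0⟩⟩ = ε^3 ∂[∂[f]] ∘ ⟨⟨x, y⟩, ⟨z, 0⟩⟩.
Proof.
split; [|split].
- apply dc_homogeneous.
- apply ext_dc_shift.
- apply ext_dc_dc_idem.
Qed.
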